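(* Let $n\ge 1$ and let $C=(c_{rs})_{n\times n}$ be a pair order matrix. Consider the mixed-integer linear program in the binary variables $x_{rs}$ ($r,s\in[n]$, $r\neq s$) and the continuous variables $d_{rs}$ ($r,s\in[n]$, $r<s$): $$\min\ 2\sum_{r=1}^{n}\sum_{s=r+1}^{n} d_{rs}$$ subject to $$x_{rs}+x_{sr}\ge 1 \quad \forall r,s\in[n],\ r<s,$$ $$x_{rs}+x_{st}\le 1+x_{rt}\quad \forall r,s,t\in[n]\ \text{pairwise distinct},$$ $$d_{rs}\ge \frac{x_{rs}-x_{sr}+1}{2}-c_{rs}\quad \forall r,s\in[n],\ r<s,$$ $$d_{rs}\ge c_{rs}-\frac{x_{rs}-x_{sr}+1}{2}\quad \forall r,s\in[n],\ r<s,$$ $$x_{rs}\in\{0,1\}\quad \forall r,s\in[n],\ r\ne s.$$ This program solves the Optimal Bucket Order Problem for $C$ exactly: its optimal value equals the minimum of $D(B,C)$ over all bucket matrices $B$ of bucket orders on $[n]$, and for every optimal solution $(\bm{x},\bm{d})$ the bucket order encoded by $\bm{x}$ has a bucket matrix $B$ attaining this minimum.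
   Context: $[n]=\{1,\dots,n\}$. A bucket order (weak order) on $[n]$ is an ordered partition $B_1,\dots,B_p$ of $[n]$ into nonempty sets (buckets), $1\le p\le n$; items in the same bucket are tied, and items in an earlier bucket are preferred to (precede) items in a later bucket. Equivalently, it is a complete (total) preorder. Its bucket matrix is $B=(b_{rs})_{n\times n}$ with $b_{rs}=1$ if $r$ is preferred to $s$, $b_{rs}=0.5$ if $r$ and $s$ are tied (in particular $b_{rr}=0.5$), and $b_{rs}=0$ if $s$ is preferred to $r$. A pair order matrix is a real matrix $C=(c_{rs})_{n\times n}$ with $c_{rr}=0.5$ for all $r$, $c_{rs}\in[0,1]$, and $c_{rs}+c_{sr}=1$ for all $r\neq s$. The Optimal Bucket Order Problem (OBOP) for $C$: find a bucket order whose bucket matrix $B$ minimizes $D(B,C)=\sum_{r=1}^n\sum_{s=1}^n|b_{rs}-c_{rs}|$. A binary vector $\bm{x}$ satisfying the first two families of constraints (comparability and transitivity) encodes the weak order in which $x_{rs}=1$ if and only if $r$ precedes or is tied with $s$ (for $r\neq s$). *)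

(* Defs.v *)
From HB Require Import structures.
From mathcomp Require Import all_boot all_order all_algebra.

Set Implicit Arguments.
Unset Strict Implicit.
Unset Printing Implicit Defensive.

Import Order.TTheory GRing.Theory Num.Theory.
Local Open Scope ring_scope.

(* The items 1, ..., n are represented by 'I_n, i.e. by 0, ..., n - 1. *)

Section Minimization.
Variables (R : realFieldType) (T : Type).

Definition minimizes (P : T -> Prop) (f : T -> R) (t : T) : Prop :=
  P t /\ forall u, P u -> f t <= f u.

(* The minimum is attained, so this asserts existence and not just a bound. *)
Definition is_minimum (P : T -> Prop) (f : T -> R) (v : R) : Prop :=
  exists2 t, minimizes P f t & f t = v.

End Minimization.

Section BucketOrders.
Variable n : nat.

(* The list B_1, ..., B_p of buckets, most preferred first; finset's
   [partition] includes the requirement that no block is empty. *)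
Definition is_bucket_order (s : seq {set 'I_n}) : bool :=
  uniq s && partition [set B in s] [set: 'I_n].

Definition bucket_index (s : seq {set 'I_n}) (r : 'I_n) : nat :=
  find (fun B : {set 'I_n} => r \in B) s.

Definition precedes (s : seq {set 'I_n}) (r t : 'I_n) : bool :=
  (bucket_index s r < bucket_index s t)%N.

Definition tied (s : seq {set 'I_n}) (r t : 'I_n) : bool :=
  bucket_index s r == bucket_index s t.

End BucketOrders.

Section OBOP.
Variables (R : realFieldType) (n : nat).

Definition bucket_matrix (s : seq {set 'I_n}) : 'M[R]_n :=
  \matrix_(r, t) (if precedes s r t then 1 else if tied s r t then 2^-1 else 0).

Definition is_bucket_matrix (B : 'M[R]_n) : Prop :=
  exists2 s, is_bucket_order s & B = bucket_matrix s.

Definition pair_order_matrix (C : 'M[R]_n) : Prop :=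
  [/\ forall r, C r r = 2^-1,
      forall r s, 0 <= C r s <= 1
    & forall r s, r != s -> C r s + C s r = 1].

Definition matrix_dist (B C : 'M[R]_n) : R :=
  \sum_(r < n) \sum_(s < n) `|B r s - C r s|.

End OBOP.

Section MILP.
Variables (R : realFieldType) (n : nat).

(* A candidate solution is a pair (x, d) of square matrices. Only the entries
   x r s with r != s and d r s with r < s are variables of the program: no
   constraint, objective or encoding below reads any other entry. *)
Definition milp_feasible (C : 'M[R]_n) (xd : 'M[R]_n * 'M[R]_n) : Prop :=
  let: (x, d) := xd in
  [/\ forall r s : 'I_n, (r < s)%N -> x r s + x s r >= 1,
      forall r s t : 'I_n, r != s -> s != t -> r != t ->
        x r s + x s t <= 1 + x r t,
      forall r s : 'I_n, (r < s)%N ->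
        d r s >= (x r s - x s r + 1) / 2 - C r s,
      forall r s : 'I_n, (r < s)%N ->
        d r s >= C r s - (x r s - x s r + 1) / 2
    & forall r s : 'I_n, r != s -> x r s = 0 \/ x r s = 1].

Definition milp_objective (xd : 'M[R]_n * 'M[R]_n) : R :=
  2 * \sum_(r < n) \sum_(s < n | (r < s)%N) xd.2 r s.

Definition encodes (x : 'M[R]_n) (b : seq {set 'I_n}) : Prop :=
  forall r s : 'I_n, r != s -> (x r s = 1 <-> precedes b r s || tied b r s).

End MILP.

(* Main.v *)
Require Import Defs.
From mathcomp Require Import all_boot all_order all_algebra.
From mathcomp Require Import lra.

Import Order.TTheory GRing.Theory Num.Theory.
Local Open Scope ring_scope.

(** A feasible [x] is a total preorder on the items, and total preorders and
bucket orders are the same thing: [bucket_order_of] cuts the items into level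
sets of a numeric rank representing the preorder ([preorder_rank]), and
[bucket_index_inj] shows that no other bucket order induces it.  If [b] is
encoded by [x], the affine expression [(x r s - x s r + 1) / 2] takes the
values 1, 1/2, 0 exactly as the bucket matrix [B] of [b] does
([bucket_matrix_encoded]), so the two constraints on [d r s] say
[d r s >= `|B r s - C r s|].

Since [B] and [C] are both pair order matrices, the terms of [matrix_dist B C]
at [(r, s)] and [(s, r)] agree and the diagonal contributes nothing, whence the
factor 2 and the sum over [r < s] ([matrix_dist_upper]).  Therefore each
feasible point costs at least the distance of the bucket order it encodes
([matrix_dist_le_objective]), and each bucket order is encoded by a feasible
point that costs exactly its distance ([milp_point_feasible],
[milp_point_objective]).  The two problems thus share their minima; a minimum
exists because finitely many rank functions yield all bucket orders. *)

Section TotalPreorders.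
Set Implicit Arguments.
Unset Strict Implicit.
Variable n : nat.

(** Ranking an item by the number of items strictly before it keeps the ranks
below [n], so that ranks range over a finite type. *)
Lemma preorder_rank (le : rel 'I_n) :
    total le -> transitive le ->
  exists f : {ffun 'I_n -> 'I_n}, forall r s, le r s = (f r <= f s)%N.
Proof.
move=> le_total le_trans.
have le_refl r : le r r by have := le_total r r; rewrite orbb.
pose before r := [set s | ~~ le r s].
have before_lt r : (#|before r| < n)%N.
  rewrite -[n in leqRHS]card_ord -cardsT proper_card // properT.
  by apply/eqP => /setP/(_ r); rewrite !inE le_refl.
exists [ffun r => Ordinal (before_lt r)] => r s; rewrite !ffunE /=.
have before_sub u v : le u v -> before u \subset before v.
  move=> uv; apply/subsetP => w; rewrite !inE; apply: contra.
  exact: le_trans.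
apply/idP/idP => [rs|]; first exact/subset_leq_card/before_sub.
apply: contraLR => Nrs; rewrite -ltnNge proper_card // properE.
have sr : le s r by have := le_total r s; rewrite (negPf Nrs).
rewrite before_sub //=; apply/subsetPn; exists s; rewrite !inE ?le_refl //.
Qed.

(** The level sets of a rank function, in increasing order of rank. *)
Definition bucket_order_of (f : 'I_n -> nat) : seq {set 'I_n} :=
  [seq [set r | f r == k] | k <- sort leq (undup (codom f))].

Lemma bucket_order_ofP (f : 'I_n -> nat) : is_bucket_order (bucket_order_of f).
Proof.
set ks := sort leq (undup (codom f)).
have ks_codom k : (k \in ks) = (k \in codom f) by rewrite mem_sort mem_undup.
apply/andP; split.
  rewrite map_inj_in_uniq ?sort_uniq ?undup_uniq // => k l.
  rewrite -/ks !ks_codom => /codomP[r ->] _ /setP/(_ r).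
  by rewrite !inE eqxx => /esym/eqP.
suff -> : [set B in bucket_order_of f] = preim_partition f setT.
  exact: preim_partitionP.
apply/setP => B; rewrite inE; apply/mapP/imsetP => [[k]|[r _ ->]].
  rewrite -/ks ks_codom => /codomP[r ->] ->; exists r => //.
  by apply/setP => s; rewrite !inE eq_sym.
exists (f r); first by rewrite -/ks ks_codom codom_f.
by apply/setP => s; rewrite !inE eq_sym.
Qed.

Lemma leq_bucket_index_of (f : 'I_n -> nat) r s :
  (bucket_index (bucket_order_of f) r <= bucket_index (bucket_order_of f) s)%N
  = (f r <= f s)%N.
Proof.
set ks := sort leq (undup (codom f)).
have indexE u : bucket_index (bucket_order_of f) u = index (f u) ks.
  rewrite /bucket_index /bucket_order_of find_map /index.
  by apply: eq_find => k /=; rewrite inE eq_sym.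
have f_ks u : f u \in ks by rewrite mem_sort mem_undup codom_f.
have ks_sorted : sorted leq ks by apply: (sort_sorted leq_total).
rewrite !indexE; apply/idP/idP => [|fle].
  exact: (sorted_leq_index leq_trans leqnn ks_sorted).
rewrite leqNgt; apply/negP => lt_sr.
have fge : (f s <= f r)%N.
  by apply: (sorted_leq_index leq_trans leqnn ks_sorted) => //; apply: ltnW.
by move: lt_sr; rewrite (@anti_leq (f r) (f s)) ?ltnn // fle.
Qed.

End TotalPreorders.

Section BucketOrderTheory.
Set Implicit Arguments.
Unset Strict Implicit.
Variable n : nat.
Implicit Types (b : seq {set 'I_n}) (r s t : 'I_n).

Lemma precedes_or_tied b r s :
  precedes b r s || tied b r s = (bucket_index b r <= bucket_index b s)%N.
Proof. by rewrite orbC -leq_eqVlt. Qed.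

Lemma bucket_index_lt_size b r :
  is_bucket_order b -> (bucket_index b r < size b)%N.
Proof.
case/andP=> _ /cover_partition/setP/(_ r); rewrite in_setT => /bigcupP[B].
by rewrite inE -has_find => bB rB; apply/hasP; exists B.
Qed.

Lemma mem_nth_bucket b r i : is_bucket_order b -> (i < size b)%N ->
  (r \in nth set0 b i) = (bucket_index b r == i).
Proof.
move=> hb i_lt; have idx_lt := bucket_index_lt_size r hb.
have r_idx : r \in nth set0 b (bucket_index b r).
  by apply: (@nth_find _ set0 (fun B : {set 'I_n} => r \in B));
    rewrite has_find.
case/andP: hb => b_uniq /and3P[_ /trivIsetP b_disj _].
apply/idP/eqP => [ri | <- //]; apply/eqP; rewrite -(nth_uniq set0 _ _ b_uniq) //.
apply: contraT => neq.
have := b_disj _ _ _ _ neq; rewrite !inE !mem_nth // => /(_ isT isT).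
by move/disjointFr => /(_ _ r_idx); rewrite ri.
Qed.

Lemma bucket_index_surj b i : is_bucket_order b -> (i < size b)%N ->
  exists r, bucket_index b r = i.
Proof.
move=> hb i_lt; have [r ri] : exists r, r \in nth set0 b i.
  apply/set0Pn; apply: contraTneq hb => b_i0; rewrite negb_and.
  apply/orP; right; apply/negP => /and3P[_ _] /negP[].
  by rewrite inE -b_i0 mem_nth.
by exists r; apply/eqP; rewrite -mem_nth_bucket.
Qed.

(** Bucket indices leave no gap, so an item of index [k.+1] has one of index [k]
before it; by induction indices are as small as the strict order allows. *)
Lemma bucket_index_minimal b (g : 'I_n -> nat) : is_bucket_order b ->
    (forall r s, (bucket_index b r < bucket_index b s)%N -> (g r < g s)%N) ->
  forall r, (bucket_index b r <= g r)%N.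
Proof.
move=> hb g_mono r; have [k] := ubnP (bucket_index b r).
elim: k r => // k IH r; rewrite ltnS => idx_le.
case idx_r: (bucket_index b r) => [//|i].
have [|s idx_s] := @bucket_index_surj b i hb.
  by apply: ltn_trans (bucket_index_lt_size r hb); rewrite idx_r.
have lt_sr : (bucket_index b s < bucket_index b r)%N by rewrite idx_s idx_r.
rewrite -idx_s; apply: leq_ltn_trans (g_mono _ _ lt_sr).
by apply: IH; apply: leq_trans lt_sr idx_le.
Qed.

Lemma bucket_index_inj b b' : is_bucket_order b -> is_bucket_order b' ->
    (forall r s, (bucket_index b r <= bucket_index b s)%N
               = (bucket_index b' r <= bucket_index b' s)%N) ->
  b = b'.
Proof.
move=> hb hb' same.
have idxE r : bucket_index b r = bucket_index b' r.
  by apply/eqP; rewrite eqn_leq !bucket_index_minimal // => s t;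
    rewrite !ltnNge same.
have size_le c c' : is_bucket_order c -> is_bucket_order c' ->
    (forall r, bucket_index c r = bucket_index c' r) -> (size c <= size c')%N.
  move=> hc hc' cE; rewrite leqNgt; apply/negP.
  case/(bucket_index_surj hc) => r; rewrite cE => r_eq.
  by have := bucket_index_lt_size r hc'; rewrite r_eq ltnn.
have size_eq : size b = size b' by apply/eqP; rewrite eqn_leq !size_le.
apply: (eq_from_nth (x0 := set0) size_eq) => i i_lt; apply/setP => r.
by rewrite !mem_nth_bucket ?idxE // -size_eq.
Qed.

Lemma bucket_order_of_rank b : is_bucket_order b ->
  exists f : {ffun 'I_n -> 'I_n}, b = bucket_order_of (fun r => f r).
Proof.
move=> hb.
have [||f fP] := @preorder_rank n
  (fun r s => bucket_index b r <= bucket_index b s)%N.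
- by move=> r s; apply: leq_total.
- by move=> s r t; apply: leq_trans.
exists f; apply: bucket_index_inj => // [|r s]; first exact: bucket_order_ofP.
by rewrite leq_bucket_index_of.
Qed.

End BucketOrderTheory.

Section BucketDistance.
Set Implicit Arguments.
Unset Strict Implicit.
Variables (R : realFieldType) (n : nat).
Implicit Types (B C x d : 'M[R]_n) (b : seq {set 'I_n}).

Lemma bucket_matrix_pair_order b : pair_order_matrix (bucket_matrix R b).
Proof.
split=> [r|r s|r s _]; rewrite !mxE /precedes /tied ?ltnn ?eqxx //;
  by case: ltngtP => _; lra.
Qed.

(** The terms at [(r, s)] and [(s, r)] agree because both matrices satisfy
[c r s + c s r = 1], and the common diagonal cancels. *)
Lemma matrix_dist_upper B C : pair_order_matrix B -> pair_order_matrix C ->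
  matrix_dist B C = 2 * \sum_(r < n) \sum_(s < n | (r < s)%N) `|B r s - C r s|.
Proof.
move=> [Bd _ Bs] [Cd _ Cs]; pose F (r s : 'I_n) := `|B r s - C r s|.
have F_sym r s : F r s = F s r.
  rewrite /F; have [-> //|rs] := eqVneq r s.
  by rewrite distrC; congr `|_|; have := Bs _ _ rs; have := Cs _ _ rs; lra.
have F_diag r : F r r = 0 by rewrite /F Bd Cd subrr normr0.
transitivity (\sum_(r < n) (\sum_(s < n | (r < s)%N) F r s
                          + \sum_(s < n | (s < r)%N) F r s)).
  apply: eq_bigr => r _; rewrite (bigID (fun s : 'I_n => r < s)%N) /=.
  congr (_ + _); rewrite (bigD1 r) ?ltnn //= -/(F r r) F_diag add0r.
  by apply: eq_bigl => s; rewrite -leqNgt ltn_neqAle andbC.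
rewrite big_split /= mulr_natl mulr2n; congr (_ + _).
rewrite (exchange_big_dep xpredT) //=.
by apply: eq_bigr => r _; apply: eq_bigr => s _; rewrite F_sym.
Qed.

Lemma bucket_matrix_encoded C x d b : milp_feasible C (x, d) -> encodes x b ->
  forall r s, r != s -> bucket_matrix R b r s = (x r s - x s r + 1) / 2.
Proof.
move=> [_ _ _ _ x01] xb.
have xE r s : r != s -> x r s = (bucket_index b r <= bucket_index b s)%N%:R.
  move=> rs; have := xb r s rs; rewrite precedes_or_tied.
  case: leqP => _ [xr1 rx1]; first exact: rx1.
  by case: (x01 r s rs) => // /xr1.
move=> r s rs; rewrite mxE /precedes /tied !xE // 1?eq_sym //.
by case: ltngtP => _ /=; lra.
Qed.

Lemma matrix_dist_le_objective C x d b : pair_order_matrix C ->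
    milp_feasible C (x, d) -> encodes x b ->
  matrix_dist (bucket_matrix R b) C <= milp_objective (x, d).
Proof.
move=> hC feas xb.
rewrite matrix_dist_upper //; last exact: bucket_matrix_pair_order.
rewrite ler_wpM2l // ler_sum // => r _; rewrite ler_sum // => s rs.
have rs_neq : r != s by rewrite neq_ltn rs.
rewrite (bucket_matrix_encoded feas xb) // ler_norml.
case: feas => _ _ /(_ r s rs) ge1 /(_ r s rs) ge2 _.
by apply/andP; split; lra.
Qed.

Lemma feasible_encodes C x d : milp_feasible C (x, d) ->
  exists b, is_bucket_order b /\ encodes x b.
Proof.
move=> [x_tot x_tr _ _ x01]; pose le r s := (r == s) || (x r s == 1).
have x_le1 r s : r != s -> x r s <= 1 by move/x01=> [] ->.
have x_cmp r s : r != s -> x r s + x s r >= 1.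
  by rewrite neq_ltn => /orP[] /x_tot //; rewrite addrC.
have [||f fP] := @preorder_rank n le.
- move=> r s; rewrite /le [s == r]eq_sym; case: eqVneq => //= rs.
  case: (x01 r s rs) (x_cmp r s rs) => ->; last by rewrite eqxx.
  by rewrite add0r => sr1; rewrite [x s r == 1]eq_le x_le1 1?eq_sym // sr1 orbT.
- move=> s r t; rewrite /le; case: (eqVneq r s) => [-> //|rs] /=.
  case: (eqVneq s t) => [<- /= ->|st /eqP x_rs /eqP x_st]; first by rewrite orbT.
  case: (eqVneq r t) => //= rt; rewrite eq_le x_le1 //=.
  by have := x_tr _ _ _ rs st rt; lra.
exists (bucket_order_of (fun r => f r)); split; first exact: bucket_order_ofP.
move=> r s rs; rewrite precedes_or_tied leq_bucket_index_of -fP /le (negPf rs).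
by split=> /eqP.
Qed.

Lemma encodes_inj x b b' : is_bucket_order b -> is_bucket_order b' ->
  encodes x b -> encodes x b' -> b = b'.
Proof.
move=> hb hb' xb xb'; apply: bucket_index_inj => // r s.
have [-> | rs] := eqVneq r s; first by rewrite !leqnn.
rewrite -!precedes_or_tied; apply/idP/idP.
  by move/(xb r s rs)/(xb' r s rs).
by move/(xb' r s rs)/(xb r s rs).
Qed.

(** The cheapest feasible point encoding [b]. *)
Definition milp_point C b : 'M[R]_n * 'M[R]_n :=
  (\matrix_(r, s) (bucket_index b r <= bucket_index b s)%N%:R,
   \matrix_(r, s) `|bucket_matrix R b r s - C r s|).

Lemma milp_point_feasible C b : milp_feasible C (milp_point C b).
Proof.
have BE r s : ((milp_point C b).1 r s - (milp_point C b).1 s r + 1) / 2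
    = bucket_matrix R b r s.
  by rewrite !mxE /precedes /tied; case: ltngtP => _ /=; lra.
split=> [r s _|r s t _ _ _|r s _|r s _|r s _].
- by rewrite !mxE; case: ltngtP => _ /=; lra.
- rewrite !mxE; case: leqP => rs; case: leqP => st; case: leqP => rt /=; try lra.
  by have := leq_ltn_trans (leq_trans rs st) rt; rewrite ltnn.
- by rewrite BE [leRHS]mxE ler_norm.
- by rewrite BE [leRHS]mxE distrC ler_norm.
- by rewrite mxE; case: leqP; [right | left].
Qed.

Lemma milp_point_objective C b : pair_order_matrix C ->
  milp_objective (milp_point C b) = matrix_dist (bucket_matrix R b) C.
Proof.
move=> hC; rewrite matrix_dist_upper //; last exact: bucket_matrix_pair_order.
congr (_ * _); apply: eq_bigr => r _; apply: eq_bigr => s _; exact: mxE.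
Qed.

Lemma obop_minimum_exists C : exists b, is_bucket_order b /\
  minimizes (@is_bucket_matrix R n) (fun B => matrix_dist B C)
    (bucket_matrix R b).
Proof.
pose bo (f : {ffun 'I_n -> 'I_n}) := bucket_order_of (fun r => f r).
pose cost f := matrix_dist (bucket_matrix R (bo f)) C.
have [f _ f_min] := @Order.TotalTheory.arg_minP _ _ _ [ffun i => i] xpredT cost isT.
have bo_f := bucket_order_ofP (fun r => f r).
exists (bo f); split=> //; split=> [|B [b hb ->]]; first by exists (bo f).
by have [g ->] := bucket_order_of_rank hb; apply: f_min.
Qed.

End BucketDistance.

Theorem mainTheorem1 (R : realFieldType) (n : nat) (C : 'M[R]_n)
    (hn : (1 <= n)%N) (hC : pair_order_matrix C) :
  (exists v : R,
      is_minimum (@is_bucket_matrix R n) (fun B => matrix_dist B C) v /\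
      is_minimum (milp_feasible C) (@milp_objective R n) v) /\
  (forall x d : 'M[R]_n,
      minimizes (milp_feasible C) (@milp_objective R n) (x, d) ->
      (exists! b : seq {set 'I_n}, is_bucket_order b /\ encodes x b) /\
      (forall b : seq {set 'I_n}, is_bucket_order b -> encodes x b ->
         minimizes (@is_bucket_matrix R n) (fun B => matrix_dist B C)
           (bucket_matrix R b))).
Proof.
split.
  have [b [hb b_min]] := obop_minimum_exists C.
  exists (matrix_dist (bucket_matrix R b) C); split.
    by exists (bucket_matrix R b).
  exists (milp_point C b); last exact: milp_point_objective.
  split=> [|[x d] feas]; first exact: milp_point_feasible.
  have [b' [hb' xb']] := feasible_encodes feas.
  rewrite milp_point_objective //.
  apply: le_trans (matrix_dist_le_objective hC feas xb').
  by case: b_min => _; apply; exists b'.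
move=> x d [feas xd_min]; split.
  have [b [hb xb]] := feasible_encodes feas.
  by exists b; split=> // b' [hb' xb']; apply: encodes_inj hb hb' xb xb'.
move=> b hb xb; split=> [|B [b' hb' ->]]; first by exists b.
apply: le_trans (matrix_dist_le_objective hC feas xb) _.
by rewrite -milp_point_objective //; apply/xd_min/milp_point_feasible.
Qed.
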